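(* Let $\mathbb{K}$ be an algebraic extension of $\mathbb{Q}$ with ring of integers $\mathbb{Z}_{\mathbb{K}}$, let $\lambda\in\mathbb{Q}$, let $b$ be the denominator of $\lambda$ (the least $b\in\mathbb{N}$ with $b\lambda\in\mathbb{Z}$), and consider the differential operator $$D=\frac{d}{dz}+\frac{\lambda}{z}$$ acting on $\mathbb{K}(z)$, with denominator $T(z)=z$. Then $D$ satisfies the factorial cancellation condition with constant $b\,e^{\chi(b)}$; that is, there exists a sequence of natural numbers $\{\psi_k\}_{k\in\mathbb{N}}$ such that for every $k\in\mathbb{N}$ and every $n=0,1,\dots,k$ the operator $\psi_k\,\dfrac{z^nD^n}{n!}$ maps $\mathbb{Z}_{\mathbb{K}}[z]$ into $\mathbb{Z}_{\mathbb{K}}[z]$, and $\limsup_{k\to\infty}\psi_k^{1/k}\le b\,e^{\chi(b)}$.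
   Context: For $b\in\mathbb{N}$, $\chi(b)=\sum_{p\mid b}\frac{\log p}{p-1}$, the sum over the prime divisors $p$ of $b$. $D^n$ denotes the $n$-fold composition of $D$ (with $D^0$ the identity), and $z^nD^n$ means $D^n$ followed by multiplication by $z^n$. *)

(* Defs.v *)
From HB Require Import structures.
From mathcomp Require Import all_boot all_order all_algebra.
From mathcomp Require Import generic_quotient.
From mathcomp Require Import all_classical all_reals all_analysis.
From mathcomp Require Import ring.

Set Implicit Arguments.
Unset Strict Implicit.
Unset Printing Implicit Defensive.

Import Order.TTheory GRing.Theory Num.Theory.
Local Open Scope ring_scope.

Notation "x %:F" := (@FracField.tofrac _ x) : ring_scope.

Section RationalFunctions.
Variable K : fieldType.
Local Notation Kz := {fraction {poly K}}.
Implicit Types (f g : Kz) (p q : {poly K}).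

(* The quotient rule applied to the chosen representative of f; lemma
   deriv_fracE shows that the result does not depend on that choice. *)
Definition deriv_frac f : Kz :=
  let p := (repr f).1 in let q := (repr f).2 in
  (p^`() * q - p * q^`())%:F / (q ^+ 2)%:F.

Lemma frac_numden f : f = (repr f).1%:F / (repr f).2%:F.
Proof.
have d0 : (repr f).2%:F != 0 :> Kz by rewrite tofrac_eq0 denom_ratioP.
apply: (mulIf d0); rewrite mulfVK //.
have piM (x : {ratio {poly K}}) :
    FracField.mul (\pi_Kz x)%qT x.2%:F = x.1%:F.
  apply/eqP; rewrite !piE FracField.equivfE /FracField.mulf.
  by rewrite !numden_Ratio ?mulf_neq0 ?oner_eq0 ?denom_ratioP // !mulr1 mulrC.
by rewrite -piM reprK.
Qed.

Lemma deriv_fracE p q : q != 0 ->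
  deriv_frac (p%:F / q%:F) = (p^`() * q - p * q^`())%:F / (q ^+ 2)%:F.
Proof.
move=> q0; rewrite /deriv_frac.
set f := (p%:F / q%:F : Kz).
set n := (repr f).1; set d := (repr f).2.
have d0 : d != 0 by exact: denom_ratioP.
have e : n * q = p * d.
  apply/eqP; rewrite -tofrac_eq !rmorphM /= -eqr_div ?tofrac_eq0 //.
  by rewrite -frac_numden.
have e' : n^`() * q + n * q^`() = p^`() * d + p * d^`() by rewrite -!derivM e.
apply/eqP; rewrite eqr_div ?tofrac_eq0 ?expf_neq0 // -!rmorphM /= tofrac_eq.
apply/eqP.
have -> : (n^`() * d - n * d^`()) * q ^+ 2 =
  (n^`() * q + n * q^`()) * d * q - (n * q) * (d * q^`() + q * d^`()) by ring.
by rewrite e e'; ring.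
Qed.

End RationalFunctions.

Section FactorialCancellation.
Variable K : fieldType.
Local Notation Kz := {fraction {poly K}}.

(* p lies in Z_K[z], Z_K being the integral closure of Z in K. *)
Definition integral_poly (p : {poly K}) : Prop :=
  forall i : nat, integralOver (intr : int -> K) p`_i.

Definition maps_integral_poly (L : Kz -> Kz) : Prop :=
  forall p, integral_poly p -> exists2 q, integral_poly q & L p%:F = q%:F.

(* Positivity of psi excludes the trivial multiplier 0. *)
Definition factorial_cancellation (R : realType)
    (D : Kz -> Kz) (T : {poly K}) (C : R) : Prop :=
  exists psi : nat -> nat,
    [/\ forall k, (0 < psi k)%N,
        forall k n, (n <= k)%N ->
          maps_integral_poly
            (fun f => (psi k)%:R * ((T ^+ n)%:F * iter n D f / n`!%:R))
      & (limn_esup (fun k => ((psi k)%:R `^ (k%:R^-1))%:E) <= C%:E)%E].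

End FactorialCancellation.

(* The operator d/dz + lambda / z on K(z), with iota the embedding of Q in K. *)
Definition euler_op (K : fieldType) (iota : {rmorphism rat -> K}) (lambda : rat)
    (f : {fraction {poly K}}) : {fraction {poly K}} :=
  deriv_frac f + (iota lambda)%:P%:F / 'X%:F * f.

Definition is_denominator (lambda : rat) (b : nat) : Prop :=
  [/\ (0 < b)%N, b%:R * lambda \is a Num.int
    & forall c : nat, (0 < c)%N -> c%:R * lambda \is a Num.int -> (b <= c)%N].

Definition chi (R : realType) (b : nat) : R :=
  \sum_(p <- primes b) ln p%:R / (p%:R - 1).

(* Main.v *)
Require Import Defs.
From mathcomp Require Import all_boot all_order all_algebra.
From mathcomp Require Import all_classical all_reals all_analysis.
From mathcomp Require Import ring.
Import Order.TTheory GRing.Theory Num.Theory.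
Local Open Scope ring_scope.

(* On monomials, [z^n D^n z^m = (lambda+m)(lambda+m-1)...(lambda+m-n+1) z^m].
   With [lambda = a/b] the coefficient divided by [n!] is a generalized binomial
   coefficient with denominator dividing [b^n] times the part of [n!] supported
   on the primes of [b].  By Legendre's formula the [p]-part of [k!] is at most
   [p^(k/(p-1))], which gives the growth rate [b e^(chi b)]. *)

Lemma dvdz_prodB (d : int) (n : nat) (F G : nat -> int) :
  (forall i, (d %| F i - G i)%Z) ->
  (d %| \prod_(i < n) F i - \prod_(i < n) G i)%Z.
Proof.
move=> dFG; elim: n => [|n IHn]; first by rewrite !big_ord0 subrr.
rewrite !big_ord_recr /=.
have -> a c : a * F n - c * G n = (a - c) * F n + c * (F n - G n) by ring.
by apply: rpredD; [exact: dvdz_mulr|exact: dvdz_mull].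
Qed.

(* As [b] is invertible mod [N], we have [x = b y] mod [N] for some natural
   number [y >= n], and [y (y - 1) ... (y - n + 1)] is divisible by [n!]. *)
Lemma dvdz_prod_arith_progression (N b n : nat) (x : int) :
  coprime N b -> (N %| n`!)%N -> (N %| \prod_(i < n) (x - b%:Z * i%:Z))%Z.
Proof.
move=> co_Nb N_fact.
have N_gt0 : (0 < N)%N by rewrite (dvdn_gt0 _ N_fact) ?fact_gt0.
have /coprimezP[[u v] /= uv1] : coprimez N b by [].
pose y := (`|(v * x) %% N|%Z + n * N)%N.
have le_ny : (n <= y)%N by rewrite (leq_trans _ (leq_addl _ _)) ?leq_pmulr.
have dvd_y i : (N %| x - b%:Z * i%:Z - b%:Z * (y%:Z - i%:Z))%Z.
  (* Since [y] is [v * x] modulo [N], the Bezout relation [u * N + v * b = 1] turns [x - b * y] into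
     this multiple of [N]. *)
  apply/dvdzP; exists (x * u + b%:Z * ((v * x) %/ N)%Z - b%:Z * n%:Z).
  have yE : y%:Z = v * x - ((v * x) %/ N)%Z * N + n%:Z * N.
    rewrite {1}(divz_eq (v * x) N) /y PoszD PoszM gez0_abs; last first.
      by rewrite modz_ge0 // eqz_nat -lt0n.
    by ring.
  by rewrite yE -{1}[x]mulr1 -uv1; ring.
have dB := dvdz_prodB N n (fun i => x - b%:Z * i%:Z)
  (fun i => b%:Z * (y%:Z - i%:Z)) dvd_y.
suff dY : (N %| \prod_(i < n) (b%:Z * (y%:Z - i%:Z)))%Z.
  by have := rpredD dB dY; rewrite subrK.
rewrite big_split /= dvdz_mull //.
have -> : \prod_(i < n) (y%:Z - i%:Z) = (y ^_ n)%:Z.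
  rewrite ffact_prod (big_morph Posz PoszM (erefl 1)).
  by apply: eq_bigr => i _; rewrite subzn // (leq_trans (ltnW (ltn_ord i))).
by rewrite -bin_ffact PoszM dvdz_mull.
Qed.

(* The part of [k`!] prime to [b] already divides the numerator of the
   generalized binomial coefficient, hence only the [b]-part is cancelled. *)
Definition binom_multiplier (b k : nat) : nat := (b ^ k * k`!`_\pi(b))%N.

Lemma binom_multiplierP (K : comPzRingType) (lambda : K) (b k n m : nat)
    (x : int) :
  (0 < b)%N -> b%:R * lambda = x%:~R -> (n <= k)%N ->
  exists z : int, (binom_multiplier b k)%:R *
    \prod_(i < n) (lambda + m%:R - i%:R) = n`!%:R * z%:~R.
Proof.
move=> b_gt0 lambdaE le_nk.
have co_b : coprime (n`!`_\pi(b)^') b.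
  by rewrite (p'nat_coprime (part_pnat _ _)) // pnat_pi.
have /dvdzP[w wE] := dvdz_prod_arith_progression _ _ _ (x + b%:Z * m%:Z)
  co_b (dvdn_part _ _).
have /dvdnP[q qE] : (n`!`_\pi(b) %| k`!`_\pi(b))%N.
  by rewrite partn_dvd ?fact_gt0 // -(bin_fact le_nk) mulnCA dvdn_mulr.
(* Clearing the [n] factors uses up [b ^ n]; [q] is the excess of the [b]-part of k! over that of
   n!, and [w] the quotient by the part of n! prime to [b]. *)
exists ((b ^ (k - n) * q)%N%:Z * w).
have prodE : b%:R ^+ n * \prod_(i < n) (lambda + m%:R - i%:R) =
    (\prod_(i < n) (x + b%:Z * m%:Z - b%:Z * i%:Z))%:~R.
  rewrite -{1}(card_ord n) -prodrMl rmorph_prod; apply: eq_bigr => i _ /=.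
  by rewrite mulrBr mulrDr lambdaE !(rmorphB, rmorphD, rmorphM).
rewrite /binom_multiplier -{1}(subnK le_nk) expnD qE !natrM (natrX _ b n).
set P := \prod_(i < n) _ in prodE *.
transitivity ((b ^ (k - n))%:R * q%:R * (n`!`_\pi(b))%:R * (b%:R ^+ n * P)).
  by ring.
rewrite prodE wE -[X in _ = X%:R * _](partnC \pi(b) (fact_gt0 n)).
rewrite natrM !rmorphM /= -!pmulrn.
by ring.
Qed.

(** Fractions over powers of ['X] are stable under the operator: differentiating [z^-n] shifts
    [lambda] by [-n]. *)
Lemma euler_op_divXn (K : fieldType) (iota : {rmorphism rat -> K})
    (lambda : rat) (p : {poly K}) (n : nat) :
  euler_op iota lambda (p%:F / ('X ^+ n)%:F) =
  ('X * p^`() + (iota lambda - n%:R)%:P * p)%:F / ('X ^+ n.+1)%:F.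
Proof.
rewrite /euler_op deriv_fracE ?expf_neq0 ?polyX_eq0 // derivXn.
apply/eqP; rewrite mulf_div -!tofracM addf_div -?tofracM -?tofracD;
  rewrite ?tofrac_eq0 ?mulf_neq0 ?expf_neq0 ?polyX_eq0 //.
rewrite eqr_div ?tofrac_eq0 ?mulf_neq0 ?expf_neq0 ?polyX_eq0 //.
rewrite -!tofracM tofrac_eq; apply/eqP.
(* The exponent [n.-1] from [derivXn] is truncated at [n = 0]. *)
case: n => [|n] /=.
  by rewrite !mulr0n subr0 expr0 expr1; ring.
rewrite -mulr_natl polyCB polyC_natr !(exprS, expr2).
move: (iota lambda)%:P (n.+1%:R : {poly K}) => l c.
by ring.
Qed.

Lemma coefX_deriv (K : nzRingType) (q : {poly K}) (m : nat) :
  ('X * q^`())`_m = q`_m *+ m.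
Proof. by rewrite coefXM; case: m => [|m]; rewrite ?mulr0n ?coef_deriv. Qed.

(** Step [n] multiplies the coefficient of [z^m] by [lambda + m - n]: [m] comes from [z d/dz], the
    rest from the shift in [euler_op_divXn]. *)
Lemma iter_euler_op (K : fieldType) (iota : {rmorphism rat -> K})
    (lambda : rat) (p : {poly K}) (n : nat) :
  iter n (euler_op iota lambda) p%:F =
  (\poly_(m < size p)
     (p`_m * \prod_(i < n) (iota lambda + m%:R - i%:R)))%:F / ('X ^+ n)%:F.
Proof.
elim: n => [|n IHn] /=.
  rewrite expr0 tofrac1 divr1; congr (_%:F); rewrite -[LHS]coefK.
  by apply/polyP => m; rewrite !coef_poly big_ord0 mulr1.
rewrite IHn euler_op_divXn; congr (_%:F / _); apply/polyP => m.
rewrite coefD coefX_deriv coefCM !coef_poly big_ord_recr /=.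
case: ifP => _; last by rewrite mul0rn mulr0 addr0.
rewrite -(mulr_natl (_ * _)); set P := \prod_(i < n) _; move: P => P.
move: (iota lambda) (m%:R : K) => l c.
by ring.
Qed.

Lemma partn_primes (b n : nat) : (0 < n)%N ->
  (n`_\pi(b) = \prod_(p <- primes b) p ^ logn p n)%N.
Proof.
move=> n_gt0; rewrite (widen_partn _ (leq_maxl n b)) -big_filter.
apply: perm_big; apply: uniq_perm; rewrite ?filter_uniq ?iota_uniq ?primes_uniq //.
move=> p; rewrite mem_filter mem_index_iota ltnS leq_max.
apply: andb_idr => pb; rewrite orbC.
by move: pb; rewrite mem_primes => /and3P[_ b0 /dvdn_leq->].
Qed.

Lemma logn_fact_bound (p n : nat) : prime p -> (logn p n`! * p.-1 <= n)%N.
Proof.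
move=> p_pr; rewrite logn_fact //.
(* The extra quotient makes Legendre's sum telescope: with [a = n %/ p ^ k.+1],
   [a * p.-1 + a = a * p] is at most [n %/ p ^ k]. *)
suff: (\sum_(1 <= i < n.+1) n %/ p ^ i * p.-1 + n %/ p ^ n <= n)%N.
  by rewrite -big_distrl; apply: leq_trans; rewrite leq_addr.
elim: {1 4}n => [|k IHk]; first by rewrite big_geq // divn1.
rewrite big_nat_recr //= -addnA -mulnSr prednK ?prime_gt0 // expnSr divnMA.
by apply: leq_trans IHk; rewrite leq_add2l leq_trunc_div.
Qed.

Lemma binom_multiplier_bound (R : realType) (b k : nat) :
  (binom_multiplier b k)%:R <= (b%:R * expR (chi R b)) ^+ k.
Proof.
rewrite /binom_multiplier partn_primes ?fact_gt0 // natrM natrX exprMn.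
rewrite ler_wpM2l ?exprn_ge0 // /chi expR_sum -prodrXl natr_prod !big_seq.
apply: ler_prod => p; rewrite mem_primes => /andP[p_pr _]; rewrite ler0n /=.
have p1_gt0 : 0 < p%:R - 1 :> R by rewrite subr_gt0 ltr1n prime_gt1.
(* Writing [p] as [expR (ln p)] reduces the comparison at each prime to one of exponents. *)
rewrite -expRM_natr natrX -[X in X ^+ _]lnK ?posrE ?ltr0n ?prime_gt0 //.
rewrite -expRM_natr ler_expR mulrAC -mulrA ler_wpM2l //.
  by rewrite ln_ge0 // ler1n prime_gt0.
rewrite ler_pdivlMr // -(natrB _ (prime_gt0 p_pr)) -natrM ler_nat.
by rewrite subn1 logn_fact_bound.
Qed.

Lemma limn_esup_root_le (R : realType) (u : nat -> R) (C : R) :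
  0 <= C -> (forall k, 0 <= u k <= C ^+ k) ->
  (limn_esup (fun k => (u k `^ (k%:R^-1))%:E) <= C%:E)%E.
Proof.
move=> C_ge0 u_le.
(* The supremum skips [k = 0], where the exponent [0^-1 = 0] gives the value 1, possibly above
   [C]. *)
apply: (@le_trans _ _ (ereal_sup
    [set (u k `^ (k%:R^-1))%:E | k in [set k : nat | (0 < k)%N]]%classic)).
  by apply: ereal_inf_lbound; exists [set k : nat | (0 < k)%N]%classic => //;
    exact: (nbhs_infty_gt 0).
apply: ge_ereal_sup => _ [k /= k_gt0 <-]; rewrite lee_fin.
have /andP[u_ge0 uC] := u_le k.
have -> : C = (C ^+ k) `^ k%:R^-1.
  by rewrite -powR_mulrn // -powRrM mulfV ?powRr1 // pnatr_eq0 -lt0n.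
by rewrite ge0_ler_powR ?nnegrE ?invr_ge0 ?exprn_ge0.
Qed.

(* A morphism iota : rat -> K forces characteristic 0; together with
   algebraicity of every element it says that K / Q is algebraic. *)
Theorem theorem1 (R : realType) (K : fieldType) (iota : {rmorphism rat -> K})
  (K_algebraic : forall x : K, algebraicOver iota x)
  (lambda : rat) (b : nat) (b_den : is_denominator lambda b) :
  factorial_cancellation (euler_op iota lambda) 'X (b%:R * expR (chi R b)).
Proof.
have [b_gt0 /intrP[x xE] _] := b_den.
have iotaE : b%:R * iota lambda = x%:~R.
  by rewrite -(rmorph_nat iota) -rmorphM xE rmorph_int.
exists (binom_multiplier b); split=> [k|k n le_nk p p_int|].
- by rewrite muln_gt0 expn_gt0 b_gt0 part_gt0.
- have fact0 : n`!%:R != 0 :> K.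
    by rewrite -(rmorph_nat iota) fmorph_eq0 pnatr_eq0 -lt0n fact_gt0.
  pose g := \poly_(m < size p)
    (p`_m * \prod_(i < n) (iota lambda + m%:R - i%:R)).
  exists (((binom_multiplier b k)%:R / n`!%:R) *: g) => [m|].
    rewrite coefZ coef_poly; case: ifP => _; last first.
      by rewrite mulr0; exact: mxpoly.integral0.
    have [z zE] := binom_multiplierP _ _ _ _ _ m _ b_gt0 iotaE le_nk.
    rewrite mulrCA mulrAC zE mulrAC mulfV // mul1r.
    by apply: integral_mul => //; exact: integral_id.
  have Xn0 : ('X ^+ n)%:F != 0 :> {fraction {poly K}}.
    by rewrite tofrac_eq0 expf_neq0 ?polyX_eq0.
  have factF0 : n`!%:R != 0 :> {fraction {poly K}}.
    by rewrite -(rmorph_nat (@tofrac _)) tofrac_eq0 -polyC_natr polyC_eq0.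
  rewrite iter_euler_op -/g [_%:F * (_ / _)]mulrC mulfVK // mulrA.
  apply: (mulIf factF0); rewrite mulfVK // -!(rmorph_nat (@tofrac _)) /=.
  rewrite -!tofracM; congr (_%:F).
  rewrite mulr_natl mulr_natr -[g *+ _]scaler_nat -[_ *: g *+ _]scaler_nat.
  by rewrite scalerA mulrCA mulfV // mulr1.
- apply: (@limn_esup_root_le R (fun k => (binom_multiplier b k)%:R)) => [|k].
    by rewrite mulr_ge0 ?expR_ge0.
  by rewrite ler0n binom_multiplier_bound.
Qed.
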